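(* Let $(X,d)$ be a compact metric space, $(\Omega,\mathcal{B},\mathbf{P})$ a probability space, and $\xi=\xi(x)=\xi(x,\omega)$, $x\in X$, a separable real-valued random field which is continuous with respect to $d$ with probability one. Let $\Phi$ be an Orlicz function satisfying the $\Delta_2$ condition $\overline{\lim}_{u\to\infty}\Phi(2u)/\Phi(u)<\infty$, and assume $$\Big\|\sup_{x\in X}|\xi(x)|\Big\|_{\Phi}<\infty .$$ Then there exist a random variable $\tau_0\ge 0$ with $\|\tau_0\|_{\Phi}=1$ and a non-random function $g:[0,\operatorname{diam}(d,X)]\to[0,\infty)$ which is continuous, strictly increasing, with $g(0)=g(0+)=0$, such that with probability one $$\Delta(\xi,\delta)\le \tau_0\cdot g(\delta)\quad\text{for all }\delta\in[0,\operatorname{diam}(d,X)].$$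
   Context: For a function $f:X\to\mathbb{R}$ the modulus of continuity is $\Delta(f,\delta)=\sup_{d(x,y)\le\delta}|f(x)-f(y)|$, $\delta\ge0$, and $\operatorname{diam}(d,X)=\sup_{x,y\in X}d(x,y)$. An Orlicz function is a function $\Phi:\mathbb{R}\to[0,\infty)$ that is convex, even, continuous, twice continuously differentiable on $u\ge2$, strictly increasing on $[0,\infty)$, with $\Phi(0)=0$ and $\lim_{|u|\to\infty}\Phi(u)=\infty$. The Orlicz space $L(\Phi)$ over $(\Omega,\mathcal{B},\mathbf{P})$ carries the Luxemburg norm $\|\zeta\|_{\Phi}=\inf\{k>0:\ \mathbf{E}\,\Phi(\zeta/k)\le1\}$. *)

(* Defs.v *)
From HB Require Import structures.
From mathcomp Require Import all_boot all_order all_algebra.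
From mathcomp Require Import all_classical all_reals all_analysis.
Set Implicit Arguments. Unset Strict Implicit. Unset Printing Implicit Defensive.
Import Order.TTheory GRing.Theory Num.Theory.
Import numFieldNormedType.Exports.
Local Open Scope classical_set_scope.
Local Open Scope ring_scope.

Section Defs.
Variable R : realType.

Definition is_metric (X : Type) (d : X -> X -> R) : Prop :=
  [/\ forall x y, 0 <= d x y,
      forall x y, d x y = 0 <-> x = y,
      forall x y, d x y = d y x &
      forall x y z, d x z <= d x y + d y z].

Definition d_open (X : Type) (d : X -> X -> R) (U : set X) : Prop :=
  forall x, U x -> exists2 r : R, 0 < r & [set y | d x y < r] `<=` U.

Definition d_compact (X : Type) (d : X -> X -> R) : Prop :=
  forall (I : Type) (U : I -> set X),
    (forall i, d_open d (U i)) -> setT `<=` \bigcup_i U i ->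
    exists2 F : set I, finite_set F & setT `<=` \bigcup_(i in F) U i.

Definition d_continuous (X : Type) (d : X -> X -> R) (f : X -> R) : Prop :=
  forall x (e : R), 0 < e -> exists2 del : R, 0 < del &
    forall y, d x y < del -> `|f x - f y| < e.

Definition modcont (X : Type) (d : X -> X -> R) (f : X -> R) (del : R) : \bar R :=
  ereal_sup [set (`|f p.1 - f p.2|)%:E | p in [set p : X * X | d p.1 p.2 <= del]].

Definition diam (X : Type) (d : X -> X -> R) : \bar R :=
  ereal_sup [set (d p.1 p.2)%:E | p in [set: X * X]].

Definition orlicz (Phi : R -> R) : Prop :=
  (forall u, 0 <= Phi u) /\
      (forall (x y t : R), 0 <= t <= 1 ->
          Phi (t * x + (1 - t) * y) <= t * Phi x + (1 - t) * Phi y) /\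
      (forall u, Phi (- u) = Phi u) /\
      continuous Phi /\
      (forall u, 2 <= u -> derivable Phi u 1 /\ derivable (derive1 Phi) u 1) /\
      {within [set u : R | 2 <= u], continuous (derive1 (derive1 Phi))} /\
      (forall u v, 0 <= u -> u < v -> Phi u < Phi v) /\
      Phi 0 = 0 /\
      Phi u @[u --> +oo] --> +oo.

(** Delta_2 condition: limsup_{u -> oo} Phi(2u)/Phi(u) < oo, i.e. the ratio is
    eventually bounded above by a finite constant *)
Definition Delta2 (Phi : R -> R) : Prop :=
  exists C : R, \forall u \near +oo, Phi (2 * u) / Phi u <= C.

Definition PhiE (Phi : R -> R) (x : \bar R) : \bar R :=
  match x with
  | EFin r => (Phi r)%:E
  | _ => +oo%E
  end.

Definition luxemburg (d0 : measure_display) (Omega : measurableType d0)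
  (P : probability Omega R) (Phi : R -> R) (zeta : Omega -> \bar R) : \bar R :=
  ereal_inf [set k%:E | k in [set k : R | 0 < k /\
     (\int[P]_w PhiE Phi (zeta w * (k^-1)%:E) <= 1)%E]].

(** separability of a random field (Doob/Loeve): there is a countable set S
    and a null event N such that outside N every value xi(x,w) is the limit
    of xi(s_n,w) along some sequence s_n in S with s_n -> x. *)
Definition separable_field (d0 : measure_display) (Omega : measurableType d0)
  (P : probability Omega R) (X : Type) (d : X -> X -> R)
  (xi : X -> Omega -> R) : Prop :=
  exists S : set X, countable S /\
  exists N : set Omega, [/\ measurable N, P N = 0%E &
    forall w, ~ N w -> forall x, exists s : nat -> X,
      [/\ forall n, S (s n),
          (fun n => d (s n) x) @ \oo --> (0:R) &
          (fun n => xi (s n) w) @ \oo --> xi x w]].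

End Defs.

(* Main.v *)
(** Sampling the field along a countable dense sequence makes its supremum M
    and its moduli of continuity Z_n at scale 1/(n+1) measurable, with
    0 <= Z_n <= 2 M and Z_n -> 0 by uniform continuity.  The Delta_2 condition
    makes Phi(a M) integrable for every a, so by dominated convergence there
    are scales r_n at which the modulus Y_n satisfies
    E Phi(2^n Y_n) <= 2^-(n+1).  Since
    Phi(sup_n 2^n Y_n) <= sum_n Phi(2^n Y_n), the variable
    T = max(1, 2 M, sup_n 2^n Y_n) has E Phi(T) < oo, and almost surely
    |xi x - xi y| <= T (2^-n + d(x, y) / r_n) for all n.  Then g is, up to
    normalization, s + inf_n (2^-n + s / r_n). *)
Require Import Defs.
From HB Require Import structures.
From mathcomp Require Import all_boot all_order all_algebra.
From mathcomp Require Import all_classical all_reals all_analysis.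
From mathcomp Require Import measurable_realfun lra.
Set Implicit Arguments. Unset Strict Implicit. Unset Printing Implicit Defensive.
Import Order.TTheory GRing.Theory Num.Theory.
Import numFieldNormedType.Exports.
Local Open Scope classical_set_scope.
Local Open Scope ring_scope.

(** * Compactness: boundedness and uniform continuity of continuous functions *)

Lemma compact_increasing_cover (R : realType) (X : Type) (d : X -> X -> R)
    (V : nat -> set X) :
  d_compact d -> (forall n, d_open d (V n)) ->
  (forall n m, (n <= m)%N -> V n `<=` V m) -> (forall x, exists n, V n x) ->
  exists N, forall x, V N x.
Proof.
move=> dC oV leV covV.
have [F finF covF] : exists2 F : set nat, finite_set F &
    setT `<=` \bigcup_(i in F) V i.
  by apply: dC => // x _; have [n Vn] := covV x; exists n.
move/finite_seqP: finF covF => [s ->] covF.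
exists (\max_(i <- s) i)%N => x; have [i si Vi] := covF x I.
by apply: leV Vi; exact: leq_bigmax_seq.
Qed.

Section continuous_on_compact.
Context (R : realType) (X : Type) (d : X -> X -> R) (f : X -> R).
Hypotheses (dM : is_metric d) (dC : d_compact d) (cf : d_continuous d f).

Lemma d_continuous_bounded : exists B, forall x, `|f x| <= B.
Proof.
pose V n := [set x | `|f x| < n%:R].
have [n|n m nm x /=|x|N VN] := @compact_increasing_cover R X d V dC.
- move=> x Vx; have nx : 0 < n%:R - `|f x| by rewrite subr_gt0.
  have [r r0 fr] := @cf x _ nx.
  by exists r => // y /fr /= h; have := ler_distD (f x) 0 (f y);
    rewrite !sub0r !normrN /V /=; lra.
- by move=> /lt_le_trans; apply; rewrite ler_nat.
- by exists (Num.truncn `|f x|).+1; exact: truncnS_gt.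
by exists N%:R => x; exact/ltW/VN.
Qed.

(** A Lebesgue number argument: compactness is applied to the sets of points around which some ball
    of radius larger than [n.+1%:R^-1] has oscillation below [e]. *)
Lemma d_continuous_uniform e : 0 < e ->
  exists N, forall x y, d x y < N.+1%:R^-1 -> `|f x - f y| < e.
Proof.
case: dM => _ d_eq0 dC' dD e0.
pose V n := [set x | exists2 r, n.+1%:R^-1 < r &
  forall y z, d x y < r -> d x z < r -> `|f y - f z| < e].
have [n|n m nm x [r nr fr]|x|N VN] :=
    @compact_increasing_cover R X d V dC.
- rewrite /V; set q := n.+1%:R^-1 => x [r nr fr].
  (* The radius [r] exceeds [q] strictly, so a centre moved by less than half the gap keeps the
     radius [(r + q) / 2], still above [q]. This makes [V n] open. *)
  exists ((r - q) / 2); first by lra.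
  move=> x' /= xx'; exists ((r + q) / 2); first by lra.
  move=> y z x'y x'z; apply: fr.
    by have := dD x x' y; lra.
  by have := dD x x' z; lra.
- exists r => //; apply: le_lt_trans nr.
  by rewrite lef_pV2 ?posrE ?ltr0n// ler_nat ltnS.
- have e20 : 0 < e / 2 by lra.
  have [r r0 fr] := @cf x _ e20.
  exists (Num.truncn r^-1), r => //.
    by rewrite invf_plt ?posrE ?ltr0n// truncnS_gt.
  by move=> y z /fr hy /fr hz; have := ler_distD (f x) (f y) (f z);
    rewrite (distrC (f y) (f x)); lra.
exists N => x y xy; have [r Nr] := VN x; apply; last exact: lt_trans Nr.
by rewrite (_ : d x x = 0) ?(lt_trans _ Nr)//; apply/d_eq0.
Qed.

End continuous_on_compact.

(** * A deterministic modulus from countably many affine bounds *)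

(* An infimum of increasing affine functions is concave, so this modulus is
   subadditive, which gives its uniform continuity. *)
Section affine_envelope.
Context (R : realType) (r : nat -> R).
Hypothesis r_gt0 : forall n, 0 < r n.

(** The absolute value extends the modulus evenly to the line, so that continuity can be proved on
    all of [R]. *)
Definition affine_envelope (x : R) : R :=
  inf (range (fun n => 2^-1 ^+ n + `|x| / r n)).

Let term_ge0 (x : R) n : 0 <= 2^-1 ^+ n + `|x| / r n :> R.
Proof. by rewrite addr_ge0 ?exprn_ge0 ?invr_ge0// divr_ge0 // ltW. Qed.

Lemma affine_envelope_le x n : affine_envelope x <= 2^-1 ^+ n + `|x| / r n.
Proof. by apply: ge_inf; [exists 0 => _ [m _ <-]|exists n]. Qed.

Lemma le_affine_envelope x c :
  (forall n, c <= 2^-1 ^+ n + `|x| / r n) -> c <= affine_envelope x.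
Proof.
move=> h; apply: lb_le_inf; first by exists (2^-1 ^+ 0 + `|x| / r 0), 0%N.
by move=> _ [n _ <-].
Qed.

Lemma affine_envelope_ge0 x : 0 <= affine_envelope x.
Proof. by apply: le_affine_envelope => n; exact: term_ge0. Qed.

Lemma affine_envelope_homo (x y : R) : `|x| <= `|y| ->
  affine_envelope x <= affine_envelope y.
Proof.
move=> xy; apply: le_affine_envelope => n.
apply: le_trans (affine_envelope_le x n) _.
by rewrite lerD2l ler_wpM2r// invr_ge0 ltW.
Qed.

Lemma affine_envelope_subadd x y :
  affine_envelope (x + y) <= affine_envelope x + affine_envelope y.
Proof.
rewrite -lerBlDr; apply: le_affine_envelope => n.
rewrite lerBlDr -lerBlDl; apply: le_affine_envelope => m.
rewrite lerBlDl.
(* Of [n] and [m], take as [k] the index with the larger [r]: its slope is below both slopes, and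
   its intercept is one of the two summands. *)
have [k [rn rm kn]] : exists k, [/\ r n <= r k, r m <= r k &
    2^-1 ^+ k <= 2^-1 ^+ n + 2^-1 ^+ m :> R].
  by have [nm|mn] := leP (r n) (r m); [exists m|exists n]; split => //;
    rewrite ?(ltW mn)// ?lerDl ?lerDr exprn_ge0// invr_ge0.
apply: le_trans (affine_envelope_le _ k) _.
have le_div (z s t : R) : 0 < s -> s <= t -> `|z| / t <= `|z| / s.
  move=> s0 st; rewrite ler_wpM2l// lef_pV2 ?posrE//.
  exact: lt_le_trans st.
have hx := le_div x _ _ (r_gt0 n) rn; have hy := le_div y _ _ (r_gt0 m) rm.
have : `|x + y| / r k <= (`|x| + `|y|) / r k.
  by rewrite ler_wpM2r ?ler_normD// invr_ge0 ltW.
by rewrite mulrDl; lra.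
Qed.

Lemma affine_envelope_cvg0 e : 0 < e ->
  exists2 s, 0 < s & forall x, `|x| < s -> affine_envelope x < e.
Proof.
move=> e0.
have [n ne] : exists n, 2^-1 ^+ n < e / 2.
  have : (fun n => 2^-1 ^+ n : R) @ \oo --> (0 : R).
    by apply: cvg_expr; rewrite ger0_norm ?invr_ge0// invf_lt1// ltr1n.
  move=> /cvgr0Pnorm_lt /(_ (e / 2)) [|n _ h]; first by lra.
  exists n; apply: le_lt_trans (h n _) => //=; exact: ler_norm.
(* Below this radius the linear term of index [n] stays under [e / 2], as its intercept already
   does. *)
exists (e / 2 * r n); first by rewrite mulr_gt0// divr_gt0.
move=> x; rewrite -ltr_pdivrMr// => xe.
by apply: le_lt_trans (affine_envelope_le x n) _; lra.
Qed.

Lemma affine_envelope0 : affine_envelope 0 = 0.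
Proof.
apply/eqP; rewrite eq_le affine_envelope_ge0 andbT leNgt; apply/negP => h.
have [s s0 /(_ 0)] := affine_envelope_cvg0 h.
by rewrite normr0 => /(_ s0); rewrite ltxx.
Qed.

(** Subadditivity bounds the difference of two values by the envelope of the difference of the
    arguments, which is small near 0. *)
Lemma affine_envelope_continuous : continuous affine_envelope.
Proof.
move=> x; apply/cvgrPdist_lt => e /affine_envelope_cvg0[s s0 hs].
near=> y.
have yx : `|x - y| < s by near: y; exact: cvgr_dist_lt.
have := affine_envelope_subadd y (x - y); rewrite (addrC y) subrK => xley.
have := affine_envelope_subadd x (y - x); rewrite (addrC x) subrK => ylex.
have := hs _ yx; rewrite distrC in yx; have := hs _ yx => xe ye.
by rewrite ltr_norml; apply/andP; split; lra.
Unshelve. all: by end_near. Qed.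

End affine_envelope.

(** * Orlicz functions: suprema and the doubling condition *)

Section orlicz_function.
Context (R : realType) (Phi : R -> R).
Hypothesis PhiO : orlicz Phi.

Lemma orlicz_ge0 u : 0 <= Phi u.
Proof. by case: PhiO. Qed.

Lemma orlicz0 : Phi 0 = 0.
Proof. by case: PhiO => _ [_ [_ [_ [_ [_ [_ []]]]]]]. Qed.

Lemma orlicz_continuous : continuous Phi.
Proof. by case: PhiO => _ [_ [_ []]]. Qed.

Lemma orlicz_measurable : measurable_fun setT Phi.
Proof. by apply: continuous_measurable_fun; exact: orlicz_continuous. Qed.

Lemma orlicz_lt u v : 0 <= u -> u < v -> Phi u < Phi v.
Proof. by case: PhiO => _ [_ [_ [_ [_ [_ [+ _]]]]]]; exact. Qed.

Lemma orlicz_le u v : 0 <= u -> u <= v -> Phi u <= Phi v.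
Proof.
by move=> u0; rewrite le_eqVlt => /predU1P[->//|/(orlicz_lt u0)/ltW].
Qed.

Lemma orlicz_scale t u : 0 <= t <= 1 -> Phi (t * u) <= t * Phi u.
Proof.
case: PhiO => _ [cvx _] t01; have := cvx u 0 t t01.
by rewrite mulr0 addr0 orlicz0 mulr0 addr0.
Qed.

Lemma orlicz_large v : exists2 u0, 0 < u0 & forall u, u0 <= u -> v < Phi u.
Proof.
case: PhiO => _ [_ [_ [_ [_ [_ [_ [_]]]]]]].
move=> /cvgryPgt /(_ v) [A [_ hA]].
exists (Num.max 1 (A + 1)); first by rewrite lt_max ltr01.
by move=> u; rewrite ge_max => /andP[_ uA]; apply: hA; lra.
Qed.

(** If [Phi] exceeded [v] at the supremum, continuity would make it exceed [v] at some [f n] close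
    to the supremum. *)
Lemma orlicz_sup (f : nat -> R) v : (forall n, 0 <= f n) ->
  has_ubound (range f) -> (forall n, Phi (f n) <= v) ->
  Phi (sup (range f)) <= v.
Proof.
move=> f0 ubf fv; rewrite leNgt; apply/negP => vsup.
have supf : has_sup (range f) by split=> //; exists (f 0), 0%N.
have := @orlicz_continuous (sup (range f)).
move=> /cvgrPdist_lt /(_ (Phi (sup (range f)) - v)).
rewrite subr_gt0 => /(_ vsup) /nbhs_ballP[e /= e0 he].
have [_ [n _ <-] fn] := sup_adherent e0 supf.
have fsup : f n <= sup (range f) by apply: ub_le_sup => //; exists n.
have := he (f n); rewrite /ball /= ger0_norm ?subr_ge0// => /(_ ltac:(lra)).
rewrite ger0_norm ?subr_ge0 ?orlicz_le//.
by have := fv n; lra.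
Qed.

(** Doubling is iterated until the power of 2 passes [a]. The additive constant is there because
    [Delta2] only speaks of large [u]. *)
Lemma Delta2_scale : Delta2 Phi -> forall a, 0 <= a ->
  exists C D, [/\ 0 <= C, 0 <= D & forall u, 0 <= u ->
    Phi (a * u) <= C * Phi u + D].
Proof.
case=> C [A [_ hA]].
have [C1 [D1 [C10 D10 double]]] : exists C D, [/\ 0 <= C, 0 <= D &
    forall u, 0 <= u -> Phi (2 * u) <= C * Phi u + D].
  pose u0 := Num.max 1 (A + 1).
  (* The additive constant covers [u <= u0] by monotonicity; beyond [u0] the ratio bound applies,
     with [C] raised to a nonnegative value. *)
  exists (Num.max 0 C), (Phi (2 * u0)).
  split; rewrite ?le_max ?lexx ?orlicz_ge0//.
  move=> u uge0; have [uu0|u0u] := leP u u0.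
    apply: ler_wpDl; first by rewrite mulr_ge0 ?orlicz_ge0// le_max lexx.
    by apply: orlicz_le; lra.
  have [u_gt0 Au] : 0 < u /\ A < u.
    by move: u0u; rewrite gt_max => /andP[]; lra.
  have Phiu : 0 < Phi u by rewrite -orlicz0; exact: orlicz_lt.
  apply: ler_wpDr; first exact: orlicz_ge0.
  have := hA _ Au; rewrite /= ler_pdivrMr// => /le_trans; apply.
  by rewrite ler_wpM2r ?orlicz_ge0// le_max lexx orbT.
have pow2 n : exists C D, [/\ 0 <= C, 0 <= D & forall u, 0 <= u ->
    Phi (2 ^+ n * u) <= C * Phi u + D].
  elim: n => [|n [C2 [D2 [C20 D20 h]]]].
    by exists 1, 0; split => // u _; rewrite expr0 !mul1r addr0.
  exists (C1 * C2), (C1 * D2 + D1); split.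
  - exact: mulr_ge0.
  - by rewrite addr_ge0 ?mulr_ge0.
  - move=> u uge0; rewrite exprS -mulrA.
    apply: le_trans (double _ _) _; first by rewrite mulr_ge0 ?exprn_ge0.
    by have := ler_wpM2l C10 (h u uge0); lra.
(* With [n] the integer part of [a] plus one, [a < n <= 2 ^+ n]. *)
move=> a a0; have [C2 [D2 [C20 D20 h]]] := pow2 (Num.truncn a).+1.
exists C2, D2; split => // u uge0; apply: le_trans (h u uge0).
apply: orlicz_le; first exact: mulr_ge0.
rewrite ler_wpM2r//; apply: le_trans (ltW (truncnS_gt a)) _.
by rewrite -natrX ler_nat ltnW// ltn_expl.
Qed.

End orlicz_function.

(** * Integration, the Luxemburg norm and the random majorant *)

(* No measurability is assumed: the integral of a nonnegative function is a
   supremum over simple functions below it. *)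
Lemma ge0_le_lower_integral d0 (T : measurableType d0) (R : realType)
    (mu : {measure set T -> \bar R}) (f g : T -> \bar R) :
  (forall x, 0 <= f x)%E -> (forall x, f x <= g x)%E ->
  (\int[mu]_x f x <= \int[mu]_x g x)%E.
Proof.
move=> f0 fg; rewrite !ge0_integralTE//; last first.
  by move=> x; exact: le_trans (fg x).
by apply: ereal_sup_le => _ [h hf <-]; exists h => // x; apply: le_trans (fg x).
Qed.

(** A supremum exceeds [a] exactly when some member does, so the preimage of a ray is a countable
    union; [i0] keeps the family nonempty. *)
Lemma measurable_fun_sup_count d0 (T : measurableType d0) (R : realType)
    (I : countType) (i0 : I) (f : I -> T -> R) :
  (forall i, measurable_fun setT (f i)) ->
  (forall w, has_ubound (range (f ^~ w))) ->
  measurable_fun setT (fun w => sup (range (f ^~ w))).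
Proof.
move=> mf ubf.
apply: (measurability _ (RGenOInfty.measurableE R)) => _ [_ [a ->] <-].
rewrite setTI (_ : _ @^-1` _ = \bigcup_i [set w | a < f i w]).
  apply: countable_bigcupT_measurable => // i.
  rewrite (_ : [set w | _] = setT `&` f i @^-1` `]a, +oo[%classic).
    exact: mf.
  by rewrite setTI; apply/seteqP; split => w; rewrite /= in_itv/= andbT.
apply/seteqP; split => w /=; rewrite in_itv/= andbT.
  move=> /sup_gt[|_ [i _ <-] afi]; last by exists i.
  by exists (f i0 w), i0.
by case=> i _ /= /lt_le_trans; apply; apply: ub_le_sup => //; exists i.
Qed.

Section orlicz_integral.
Context (R : realType) (Phi : R -> R) (d0 : measure_display)
  (Omega : measurableType d0) (P : probability Omega R).
Hypothesis PhiO : orlicz Phi.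

Let measurable_Phi (f : Omega -> R) : measurable_fun setT f ->
  measurable_fun setT (fun w => (Phi (f w))%:E).
Proof.
move=> mf; apply/measurable_EFinP; apply: measurableT_comp => //.
exact: orlicz_measurable.
Qed.

Let mulr_measurable (a : R) (f : Omega -> R) : measurable_fun setT f ->
  measurable_fun setT (fun w => a * f w).
Proof. by move=> mf; exact: measurable_funM. Qed.

Lemma probability_integral_cst c : (\int[P]_w c%:E = c%:E)%E.
Proof.
transitivity (c%:E * P setT)%E; first exact: integral_cst.
by rewrite probability_setT mule1.
Qed.

(** The factor [l] is the Luxemburg norm of [T]. It is finite by convexity of [Phi], and positive
    because [T] is bounded below by 1 while [Phi] is unbounded. *)
Lemma luxemburg_normalize (T : Omega -> R) :
  measurable_fun setT T -> (forall w, 1 <= T w) ->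
  (\int[P]_w (Phi (T w))%:E < +oo)%E ->
  exists2 l, 0 < l & luxemburg P Phi (fun w => (T w / l)%:E) = 1%E.
Proof.
move=> mT T1 intT.
have intT_ge0 : (0 <= \int[P]_w (Phi (T w))%:E)%E.
  by apply: integral_ge0 => w _; rewrite lee_fin orlicz_ge0.
pose K := [set k : R | 0 < k /\ (\int[P]_w (Phi (T w * k^-1))%:E <= 1)%E].
have K0 : K !=set0.
  (* As [k >= 1], convexity gives [Phi (T / k) <= Phi T / k], and dividing by [k] brings the
     integral below 1. *)
  pose k := Num.max 1 (fine (\int[P]_w (Phi (T w))%:E)%E).
  have k1 : 1 <= k by rewrite le_max lexx.
  have k0 : 0 < k by exact: lt_le_trans k1.
  exists k; split => //.
  apply: (@le_trans _ _ (\int[P]_w (k^-1%:E * (Phi (T w))%:E))%E).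
    apply: ge0_le_lower_integral => w; first by rewrite lee_fin orlicz_ge0.
    rewrite -EFinM lee_fin mulrC; apply: orlicz_scale => //.
    by rewrite invr_ge0 (ltW k0) invf_le1.
  rewrite ge0_integralZl_EFin//; last 3 first.
  - by move=> w _; rewrite lee_fin orlicz_ge0.
  - exact: measurable_Phi.
  - by rewrite invr_ge0 ltW.
  rewrite -[X in (_ * X)%E]fineK ?ge0_fin_numE// -EFinM lee_fin.
  by rewrite mulrC ler_pdivrMr// mul1r le_max lexx orbT.
(* For [k < u0^-1] the variable [T / k] exceeds [u0] everywhere, so its [Phi] integral exceeds 1 and
   [k] is not admissible. *)
have [u0 u0_gt0 hu0] := orlicz_large PhiO 1.
have lbK k : K k -> u0^-1 <= k.
  case=> k0 intk; rewrite leNgt; apply/negP => ku0.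
  suff : (1%:E < \int[P]_w (Phi (T w * k^-1))%:E)%E by rewrite ltNge intk.
  apply: (@lt_le_trans _ _ (\int[P]_w (Phi k^-1)%:E)%E).
    rewrite probability_integral_cst lte_fin; apply: hu0.
    by rewrite -[u0]invrK lef_pV2 ?posrE ?invr_gt0// ltW.
  apply: ge0_le_lower_integral => w; rewrite lee_fin ?orlicz_ge0//.
  apply: orlicz_le => //; first by rewrite invr_ge0 ltW.
  by rewrite ler_peMl// invr_ge0 ltW.
have infK : has_inf K by split=> //; exists u0^-1 => k; exact: lbK.
have l0 : 0 < inf K.
  apply: (@lt_le_trans _ _ u0^-1); first by rewrite invr_gt0.
  by apply: lb_le_inf => // k; exact: lbK.
exists (inf K) => //.
have KP k : 0 < k -> K (inf K * k) <->
    (\int[P]_w PhiE Phi ((T w / inf K)%:E * (k^-1)%:E) <= 1)%E.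
  move=> k0; rewrite /K /= (_ : 0 < inf K * k); last exact: mulr_gt0.
  rewrite (_ : (fun w => (Phi (T w * (inf K * k)^-1))%:E) =
    (fun w => PhiE Phi ((T w / inf K)%:E * (k^-1)%:E)%E)).
    by split => [[]|].
  by apply/funext => w /=; rewrite invfM mulrA.
rewrite /luxemburg; apply/eqP; rewrite eq_le; apply/andP; split.
  apply/lee_addgt0Pr => e e0.
  (* The tolerance is relative to [inf K], so that division by [inf K] leaves [1 + e]. *)
  have [k Kk ke] := inf_adherent (mulr_gt0 l0 e0) infK.
  have k0 : 0 < k by case: Kk.
  apply: (@le_trans _ _ (k / inf K)%:E).
    apply: ereal_inf_lbound; exists (k / inf K) => //=.
    split; first exact: divr_gt0.
    by apply/KP; [exact: divr_gt0|rewrite mulrC divfK// gt_eqF].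
  by rewrite -EFinD lee_fin ler_pdivrMr// mulrDl mul1r (mulrC e) ltW.
apply: le_ereal_inf_tmp => _ [k [k0 intk] <-].
have Kk : K (inf K * k) by apply/KP.
by rewrite lee_fin -(ler_pM2l l0) mulr1; apply: ge_inf => //; case: infK.
Qed.

(** Since [a * M = (a * k) * (M / k)], scaling by [a * k] bounds the integrand by an affine function
    of [Phi (M / k)], and constants are integrable for a probability. *)
Lemma Delta2_integral_finite (M : Omega -> R) (k a : R) :
  Delta2 Phi -> measurable_fun setT M -> (forall w, 0 <= M w) ->
  0 < k -> (\int[P]_w (Phi (M w / k))%:E < +oo)%E -> 0 <= a ->
  (\int[P]_w (Phi (a * M w))%:E < +oo)%E.
Proof.
move=> PhiD mM M0 k0 intM a0.
have ak0 : 0 <= a * k by rewrite mulr_ge0// ltW.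
have [C [D [C0 D0 h]]] := Delta2_scale PhiO PhiD ak0.
have mMk : measurable_fun setT (fun w => M w / k).
  by under eq_fun do rewrite mulrC; exact: mulr_measurable.
apply: (@le_lt_trans _ _
    (\int[P]_w (C%:E * (Phi (M w / k))%:E + D%:E))%E).
  apply: ge0_le_lower_integral => w; first by rewrite lee_fin orlicz_ge0.
  rewrite -EFinM -EFinD lee_fin; apply: le_trans (h (M w / k) _).
    by rewrite mulrACA divff ?mulr1// gt_eqF.
  by rewrite divr_ge0// ltW.
rewrite ge0_integralD//=.
- rewrite ge0_integralZl_EFin//; last 2 first.
  + by move=> w _; rewrite lee_fin orlicz_ge0.
  + exact: measurable_Phi.
  rewrite probability_integral_cst lte_add_pinfty ?ltry//.
  by rewrite lte_mul_pinfty// ?lee_fin// integral_ge0.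
- by move=> w _; apply: mule_ge0; rewrite lee_fin//; exact: orlicz_ge0.
- apply/measurable_EFinP/measurable_funM => //.
  by apply/measurable_EFinP; exact: measurable_Phi.
Qed.

Lemma Phi_dominated_cvg0 (M : Omega -> R) (Z : nat -> Omega -> R) :
  measurable_fun setT M -> (forall m, measurable_fun setT (Z m)) ->
  (forall m w, 0 <= Z m w <= M w) -> (forall w, Z ^~ w @ \oo --> (0 : R)) ->
  (\int[P]_w (Phi (M w))%:E < +oo)%E ->
  (fun m => \int[P]_w (Phi (Z m w))%:E)%E @ \oo --> 0%E.
Proof.
move=> mM mZ ZM Z0 intM.
have Zcvg : {ae P, forall w, setT w ->
    (fun m => (Phi (Z m w))%:E) @ \oo --> cst 0%E w}.
  apply: aeW => w _; apply: cvg_EFin; first exact: nearW.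
  have : (Phi \o Z ^~ w) @ \oo --> Phi 0.
    apply: continuous_cvg (Z0 w); exact: orlicz_continuous.
  by rewrite orlicz0.
have iM : P.-integrable setT (fun w => (Phi (M w))%:E).
  apply/integrableP; split; first exact: measurable_Phi.
  by under eq_integral do rewrite gee0_abs ?lee_fin ?orlicz_ge0//.
have ZleM : {ae P, forall w m, setT w ->
    (`|(Phi (Z m w))%:E| <= (Phi (M w))%:E)%E}.
  apply: aeW => w m _; rewrite gee0_abs ?lee_fin ?orlicz_ge0//.
  by have /andP[Z_ge0 ZleM] := ZM m w; exact: orlicz_le.
have [_ _] := dominated_convergence measurableT
  (fun m => measurable_Phi (mZ m)) (measurable_cst 0%E) Zcvg iM ZleM.
by rewrite integral0.
Qed.

(** Along a sparse sequence of indices [Z] decays so fast that one variable with integrable [Phi]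
    controls all the chosen terms, with geometric weights. *)
Lemma orlicz_majorant (M : Omega -> R) (Z : nat -> Omega -> R) (k : R) :
  Delta2 Phi -> measurable_fun setT M -> (forall m, measurable_fun setT (Z m)) ->
  (forall m w, 0 <= Z m w <= 2 * M w) -> (forall w, Z ^~ w @ \oo --> (0 : R)) ->
  0 < k -> (\int[P]_w (Phi (M w / k))%:E < +oo)%E ->
  exists (m : nat -> nat) (T : Omega -> R),
    [/\ measurable_fun setT T, (forall w, 1 <= T w /\ 2 * M w <= T w),
        (\int[P]_w (Phi (T w))%:E < +oo)%E &
        {ae P, forall w n, Z (m n) w <= 2^-1 ^+ n * T w}].
Proof.
move=> PhiD mM mZ ZM Z0 k0 intM.
have M0 w : 0 <= M w.
  by have /andP[h1 h2] := ZM 0%N w; have := le_trans h1 h2; rewrite pmulr_rge0.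
have intaM a : 0 <= a -> (\int[P]_w (Phi (a * M w))%:E < +oo)%E.
  exact: Delta2_integral_finite intM.
(* These bounds sum to 1 over [n], which will bound the integral of the series [v]. *)
have small n : exists m,
    (\int[P]_w (Phi (2 ^+ n * Z m w))%:E <= (1 / (2 ^ n.+1)%:R)%:E)%E.
  have : (fun m => \int[P]_w (Phi (2 ^+ n * Z m w))%:E)%E @ \oo --> 0%E.
    apply: (@Phi_dominated_cvg0 (fun w => 2 ^+ n * 2 * M w)).
    - exact: mulr_measurable.
    - by move=> m; exact: mulr_measurable.
    - move=> m w; have /andP[Z_ge0 ZleM] := ZM m w.
      by rewrite mulr_ge0 ?exprn_ge0//= -mulrA ler_wpM2l ?exprn_ge0.
    - move=> w; rewrite -(mulr0 (2 ^+ n)).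
      by apply: cvgM => //; exact: cvg_cst.
    - by apply: intaM; rewrite mulr_ge0 ?exprn_ge0.
  have e0 : 0 < 1 / (2 ^ n.+1)%:R :> R by rewrite divr_gt0// ltr0n expn_gt0.
  move=> /(_ [set x : \bar R | (x < (1 / (2 ^ n.+1)%:R)%:E)%E]) [].
    by apply: open_nbhs_nbhs; split; [exact: open_ereal_lt_ereal|rewrite /= lte_fin].
  by move=> m _ /(_ m (leqnn m)) /ltW; exists m.
have [m hm] := choice small.
pose v w := (\sum_(n <oo) (Phi (2 ^+ n * Z (m n) w))%:E)%E.
have mPhiZ n : measurable_fun setT (fun w => (Phi (2 ^+ n * Z (m n) w))%:E).
  exact/measurable_Phi/mulr_measurable.
have mv : measurable_fun setT v.
  by apply: ge0_emeasurable_sum => // n w _ _; rewrite lee_fin orlicz_ge0.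
have v0 w : (0 <= v w)%E.
  by apply: nneseries_ge0 => n _ _; rewrite lee_fin orlicz_ge0.
have Phi_le_v n w : ((Phi (2 ^+ n * Z (m n) w))%:E <= v w)%E.
  rewrite /v (@nneseriesD1 _ _ n)// => [|i _]; last by rewrite lee_fin orlicz_ge0.
  by rewrite leeDl// nneseries_ge0// => i _ _; rewrite lee_fin orlicz_ge0.
have intv : (\int[P]_w v w <= 1)%E.
  rewrite integral_nneseries//; last first.
    by move=> n w _; rewrite lee_fin orlicz_ge0.
  apply: le_trans (epsilon_trick0 xpredT ler01); apply: lee_nneseries => // n _.
  by move=> _; apply: integral_ge0 => w _; rewrite lee_fin orlicz_ge0.
pose G := [set w | v w \is a fin_num].
have mG : measurable G by rewrite -[G]setTI; exact: emeasurable_fin_num.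
(* Cutting to the event where the series is finite makes the family bounded at every [w], so that
   its real supremum is genuine and measurable. *)
pose f n w := 2 ^+ n * Z (m n) w * \1_G w.
have f0 n w : 0 <= f n w.
  rewrite mulr_ge0// mulr_ge0 ?exprn_ge0//.
  by have /andP[] := ZM (m n) w.
have fv n w : ((Phi (f n w))%:E <= v w)%E.
  rewrite /f indicE; case: (w \in G); first by rewrite mulr1.
  by rewrite mulr0 orlicz0.
have ubf w : has_ubound (range (f ^~ w)).
  have [wG|wG] := pselect (G w); last first.
    by exists 0 => _ [n _ <-]; rewrite /f indicE memNset// mulr0.
  (* [Phi (f n w)] is at most the finite [v w] and [Phi] tends to infinity, so the [f n w] cannot
     pass [u0]. *)
  have [u0 _ hu0] := orlicz_large PhiO (fine (v w)).
  exists u0 => _ [n _ <-]; rewrite leNgt; apply/negP => /ltW /hu0.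
  by rewrite ltNge -lee_fin fineK// fv.
pose T0 w := sup (range (f ^~ w)).
have fT0 n w : f n w <= T0 w by apply: ub_le_sup => //; exists n.
have T00 w : 0 <= T0 w by exact: le_trans (fT0 0%N w).
have PhiT0 w : ((Phi (T0 w))%:E <= v w)%E.
  have := fv ^~ w; have := v0 w; case: (v w) => [r _ h|_ _|//].
    by rewrite lee_fin; apply: orlicz_sup => // n; rewrite -lee_fin.
  by rewrite leey.
have mT0 : measurable_fun setT T0.
  apply: (measurable_fun_sup_count 0%N) => // n; apply: measurable_funM.
    exact: mulr_measurable.
  exact: measurable_indic.
(* The 1 serves the normalization, [2 * M] the pairs of distant points, and [T0] the pairs of close
   points. [Phi] of the maximum is at most the sum of the three values. *)
pose T w := Num.max (Num.max 1 (2 * M w)) (T0 w).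
exists m, T; split.
- by do 2!apply: measurable_maxr => //; exact: mulr_measurable.
- by move=> w; split; rewrite /T !le_max lexx ?orbT.
- apply: (@le_lt_trans _ _
    (\int[P]_w ((Phi 1)%:E + (Phi (2 * M w))%:E + v w))%E).
    apply: ge0_le_lower_integral => w; first by rewrite lee_fin orlicz_ge0.
    have := PhiT0 w; have := v0 w; case: (v w) => [r r0 h|_ _|//]; last first.
      by rewrite addey// leey.
    rewrite -!EFinD lee_fin; rewrite !lee_fin in r0 h.
    have p1 := orlicz_ge0 PhiO 1; have p2 := orlicz_ge0 PhiO (2 * M w).
    rewrite /T; case: (leP _ (T0 w)) => _; first by lra.
    by case: (leP 1 (2 * M w)) => _; lra.
  rewrite ge0_integralD//; last 2 first.
  + by move=> w _; rewrite adde_ge0// lee_fin orlicz_ge0.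
  + apply: emeasurable_funD => //; apply: measurable_Phi.
    exact: mulr_measurable.
  apply: lte_add_pinfty; last exact: le_lt_trans intv (ltry _).
  rewrite ge0_integralD//; last 3 first.
  + by move=> w _; rewrite lee_fin orlicz_ge0.
  + by move=> w _; rewrite lee_fin orlicz_ge0.
  + by apply: measurable_Phi; exact: mulr_measurable.
  by rewrite probability_integral_cst lte_add_pinfty ?ltry// intaM.
(* An integrable series is finite almost everywhere, so the cut to [G] is invisible there. *)
- have iv : P.-integrable setT v.
    apply/integrableP; split => //.
    by under eq_integral do rewrite gee0_abs//; exact: le_lt_trans intv (ltry _).
  apply: filterS (integrable_ae measurableT iv) => w /(_ I) wG n.
  have : f n w <= T w by rewrite /T le_max fT0 orbT.
  rewrite /f indicE mem_set// mulr1 exprVn => h.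
  by rewrite ler_pdivlMl// exprn_gt0.
Qed.

End orlicz_integral.

(** * Sampling the field along a countable set *)

Lemma countable_range (X : Type) (x0 : X) (S : set X) : countable S ->
  exists e : nat -> X, forall x, S x -> exists n, e n = x.
Proof.
move=> /countable_injP[f injf].
(* [S] may be finite or empty: an index outside the image of [f] may go to any point, and [x0] shows
   that one exists. *)
have [e eP] : {e : nat -> X & forall n, (exists2 x, S x & f x = n) ->
    S (e n) /\ f (e n) = n}.
  apply: (@choice _ _ (fun n y => (exists2 x, S x & f x = n) -> S y /\ f y = n)) => n.
  by have [[x Sx <-]|nx] := pselect (exists2 x, S x & f x = n); [exists x|exists x0].
exists e => x Sx; exists (f x).
have [Se fe] := eP (f x) (ex_intro2 _ _ x Sx erefl).
by apply: injf; rewrite ?inE.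
Qed.

Section sampled_field.
Context (R : realType) (X : Type) (d : X -> X -> R) (d0 : measure_display)
  (Omega : measurableType d0) (xi : X -> Omega -> R) (e : nat -> X)
  (G : set Omega).
Hypotheses (dM : is_metric d) (dC : d_compact d).
Hypotheses (mxi : forall x, measurable_fun setT (xi x)) (mG : measurable G).
Hypothesis xi_cont : forall w, G w -> d_continuous d (xi ^~ w).
Hypothesis xi_dense : forall w x s, G w -> 0 < s ->
  exists i, d (e i) x < s /\ `|xi (e i) w - xi x w| < s.

(** Setting the field to 0 off the good event keeps every supremum below bounded for all [w]. *)
Let eta i w := xi (e i) w * \1_G w.

Definition sample_sup w := sup (range (fun i => `|eta i w|)).

(** The 0/1 factor lets the supremum range over a fixed countable index set; far pairs contribute 0,
    harmless among nonnegative terms. *)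
Definition sample_modulus (s : R) w :=
  sup (range (fun p : nat * nat =>
    `|eta p.1 w - eta p.2 w| * (d (e p.1) (e p.2) < s)%R%:R)).

Let etaE i w : G w -> eta i w = xi (e i) w.
Proof. by move=> Gw; rewrite /eta indicE mem_set// mulr1. Qed.

Let eta_out i w : ~ G w -> eta i w = 0.
Proof. by move=> Gw; rewrite /eta indicE memNset// mulr0. Qed.

Let measurable_eta i : measurable_fun setT (eta i).
Proof. by apply: measurable_funM => //; exact: measurable_indic. Qed.

Let ub_eta w : has_ubound (range (fun i => `|eta i w|)).
Proof.
have [Gw|Gw] := pselect (G w).
  have [B fB] := d_continuous_bounded dC (xi_cont Gw).
  by exists B => _ [i _ <-]; rewrite etaE.
by exists 0 => _ [i _ <-]; rewrite eta_out// normr0.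
Qed.

Let eta_le i w : `|eta i w| <= sample_sup w.
Proof. by apply: ub_le_sup => //; exists i. Qed.

Let incr_le s p w :
  `|eta p.1 w - eta p.2 w| * (d (e p.1) (e p.2) < s)%R%:R <= 2 * sample_sup w.
Proof.
have := eta_le p.1 w; have := eta_le p.2 w.
have := ler_normB (eta p.1 w) (eta p.2 w); have := normr_ge0 (eta p.1 w).
by case: (_ < s); rewrite ?mulr1 ?mulr0; lra.
Qed.

Let ub_incr s w : has_ubound (range (fun p : nat * nat =>
  `|eta p.1 w - eta p.2 w| * (d (e p.1) (e p.2) < s)%R%:R)).
Proof. by exists (2 * sample_sup w) => _ [p _ <-]; exact: incr_le. Qed.

Lemma measurable_sample_sup : measurable_fun setT sample_sup.
Proof.
apply: (measurable_fun_sup_count 0%N) => // i.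
exact: measurableT_comp.
Qed.

Lemma measurable_sample_modulus s : measurable_fun setT (sample_modulus s).
Proof.
apply: (measurable_fun_sup_count (0, 0)%N) => // p.
apply: measurable_funM => //; apply: measurableT_comp => //.
exact: measurable_funB.
Qed.

Lemma sample_modulus_bound s w : 0 <= sample_modulus s w <= 2 * sample_sup w.
Proof.
apply/andP; split; last first.
  by apply: ge_sup => [|_ [p _ <-]]; [eexists; exists (0, 0)%N|exact: incr_le].
have le0 : 0 <= `|eta 0 w - eta 0 w| * (d (e 0) (e 0) < s)%R%:R by rewrite mulr_ge0.
by apply: le_trans le0 _; apply: ub_le_sup => //; exists (0, 0)%N.
Qed.

Lemma sample_modulus_cvg0 w :
  (fun n => sample_modulus n.+1%:R^-1 w) @ \oo --> (0 : R).
Proof.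
apply/cvgr0Pnorm_lt => s s0.
have s20 : 0 < s / 2 by lra.
have [N hN] : exists N, forall p, d (e p.1) (e p.2) < N.+1%:R^-1 ->
    `|eta p.1 w - eta p.2 w| < s / 2.
  have [Gw|Gw] := pselect (G w); last first.
    by exists 0%N => p _; rewrite !eta_out// subrr normr0.
  have [N hN] := d_continuous_uniform dM dC (xi_cont Gw) s20.
  by exists N => p /hN; rewrite !etaE.
exists N => // n /= Nn.
have /andP[+ _] := sample_modulus_bound n.+1%:R^-1 w.
move=> /ger0_norm ->; apply: (@le_lt_trans _ _ (s / 2)); last by lra.
apply: ge_sup; first by eexists; exists (0, 0)%N.
move=> _ [p _ <-]; case: ltP => [dp|_]; last by rewrite mulr0 ltW.
rewrite mulr1 ltW// hN//; apply: lt_le_trans dp _.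
by rewrite lef_pV2 ?posrE ?ltr0n// ler_nat ltnS.
Qed.

Lemma sample_sup_le w B : 0 <= B -> (G w -> forall x, `|xi x w| <= B) ->
  sample_sup w <= B.
Proof.
move=> B0 hB; apply: ge_sup; first by eexists; exists 0%N.
move=> _ [i _ <-]; have [Gw|Gw] := pselect (G w); first by rewrite etaE// hB.
by rewrite eta_out// normr0.
Qed.

Lemma field_incr_le_sup w x y : G w -> `|xi x w - xi y w| <= 2 * sample_sup w.
Proof.
move=> Gw; suff h z : `|xi z w| <= sample_sup w.
  by have := ler_normB (xi x w) (xi y w); have := h x; have := h y; lra.
apply/ler_addgt0Pr => s s0; have [i [_ his]] := xi_dense z Gw s0.
have := eta_le i w; rewrite etaE//.
by have := ler_distD (xi (e i) w) (xi z w) 0; rewrite !subr0 (distrC (xi z w)); lra.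
Qed.

(* The sample pairs approximating (x, y) may be slightly further apart than x
   and y, whence the strict inequality d x y < s. *)
Lemma field_incr_le_modulus w x y s : G w -> d x y < s ->
  `|xi x w - xi y w| <= sample_modulus s w.
Proof.
case: dM => _ _ dsym dtri Gw xys.
apply/ler_addgt0Pr => t t0.
pose u := Num.min (t / 2) ((s - d x y) / 2).
have u0 : 0 < u by rewrite lt_min; apply/andP; split; lra.
have ut : u <= t / 2 by rewrite ge_min lexx.
have us : u <= (s - d x y) / 2 by rewrite ge_min lexx orbT.
have [i [dix fix1]] := xi_dense x Gw u0.
have [j [djy fjy]] := xi_dense y Gw u0.
have dij : d (e i) (e j) < s.
  by have := dtri (e i) x (e j); have := dtri x y (e j);
    rewrite (dsym y (e j)); lra.
have : `|xi (e i) w - xi (e j) w| <= sample_modulus s w.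
  by apply: ub_le_sup => //; exists (i, j); rewrite //= !etaE// dij mulr1.
have := ler_distD (xi (e i) w) (xi x w) (xi y w).
have := ler_distD (xi (e j) w) (xi (e i) w) (xi y w).
by rewrite (distrC (xi x w) (xi (e i) w)); lra.
Qed.

End sampled_field.

(** * Almost sure affine bounds for the increments of the field *)

Lemma random_modulus (R : realType) (X : Type) (d : X -> X -> R)
    (d0 : measure_display) (Omega : measurableType d0) (P : probability Omega R)
    (xi : X -> Omega -> R) (Phi : R -> R) :
  is_metric d -> d_compact d -> (forall x, measurable_fun setT (xi x)) ->
  separable_field P d xi -> {ae P, forall w, d_continuous d (xi ^~ w)} ->
  orlicz Phi -> Delta2 Phi ->
  (luxemburg P Phi (fun w => ereal_sup [set (`|xi x w|)%:E | x in [set: X]])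
     < +oo)%E ->
  exists (r : nat -> R) (T : Omega -> R),
    [/\ (forall n, 0 < r n), measurable_fun setT T, (forall w, 1 <= T w),
        (\int[P]_w (Phi (T w))%:E < +oo)%E &
        {ae P, forall w x y n,
          `|xi x w - xi y w| <= T w * (2^-1 ^+ n + d x y / r n)}].
Proof.
move=> dM dC mxi [S [cS [N [mN PN sepN]]]] [N' [mN' PN' contN']] PhiO PhiD xiL.
(* On an empty space the increment bound is vacuous and constants suffice. *)
have [[x0]|X0] := pselect (inhabited X); last first.
  exists (fun=> 1), (fun=> 1); split=> //.
    by rewrite probability_integral_cst ltry.
  by apply: aeW => w x; case: X0.
have [e eS] := countable_range x0 cS.
(* The exceptional events of separability and of continuity are both removed. *)
pose G := ~` (N `|` N').
have mNN : measurable (N `|` N') by exact: measurableU.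
have mG : measurable G by exact: measurableC.
have aeG : {ae P, forall w, G w}.
  exists (N `|` N'); split => //; first by rewrite measureU0.
  by move=> w /= /contrapT.
have xi_cont w : G w -> d_continuous d (xi ^~ w).
  by move=> Gw; apply: contrapT => nc; apply: Gw; right; apply: contN'.
have xi_dense w x s : G w -> 0 < s ->
    exists i, d (e i) x < s /\ `|xi (e i) w - xi x w| < s.
  move=> Gw s0; have [u [Su ux xiu]] := sepN w (fun Nw => Gw (or_introl Nw)) x.
  have [n [un1 un2]] : exists n, `|d (u n) x| < s /\ `|xi x w - xi (u n) w| < s.
    have {}ux : \forall n \near \oo, `|d (u n) x| < s by exact: cvgr0_norm_lt.
    have {}xiu : \forall n \near \oo, `|xi x w - xi (u n) w| < s.
      exact: cvgr_dist_lt.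
    by have [n] := filter_ex (filterI ux xiu); exists n.
  have [i ei] := eS _ (Su n); exists i.
  by rewrite ei distrC; split => //; apply: le_lt_trans un1; exact: ler_norm.
pose M := sample_sup xi e G.
pose Z n := sample_modulus d xi e G n.+1%:R^-1.
have [k [k0 intk]] : exists k, 0 < k /\ (\int[P]_w PhiE Phi (ereal_sup
    [set (`|xi x w|)%:E | x in [set: X]] * (k^-1)%:E) <= 1)%E.
  by have /ereal_inf_lt[_ [k kP _] _] := xiL; exists k.
have intM : (\int[P]_w (Phi (M w / k))%:E < +oo)%E.
  apply: le_lt_trans (le_lt_trans intk (ltry _)).
  (* The supremum over all of [X] is not known to be measurable, so the integrals are compared
     pointwise. *)
  apply: ge0_le_lower_integral => w; first by rewrite lee_fin orlicz_ge0.
  set s := ereal_sup _.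
  have xis x : (`|xi x w|%:E <= s)%E by apply: ereal_sup_ubound; exists x.
  have := xis x0; case: s xis => [r| |//] xis; last first.
    by move=> _; rewrite gt0_mulye ?lte_fin ?invr_gt0//= leey.
  rewrite lee_fin => r0; rewrite /= lee_fin; apply: orlicz_le => //.
    rewrite divr_ge0// ?(ltW k0)//.
    by have /andP[] := sample_modulus_bound e dC xi_cont 1 w; rewrite /M; lra.
  rewrite ler_pM2r ?invr_gt0//; apply: sample_sup_le.
    exact: le_trans r0.
  by move=> _ x; rewrite -lee_fin.
have [m [T [mT T1 intT Tae]]] := @orlicz_majorant _ Phi _ _ P PhiO M Z k PhiD
  (measurable_sample_sup e dC mxi mG xi_cont)
  (fun n => measurable_sample_modulus e dC mxi mG xi_cont n.+1%:R^-1)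
  (fun n w => sample_modulus_bound e dC xi_cont n.+1%:R^-1 w)
  (sample_modulus_cvg0 e dM dC xi_cont) k0 intM.
exists (fun n => (m n).+1%:R^-1), T; split => //; first by move=> w; case: (T1 w).
apply: filterS2 aeG Tae => w Gw Tw x y n.
have T0 : 0 < T w by case: (T1 w) => /(lt_le_trans ltr01).
(* Close pairs are controlled by the modulus, hence by the intercept. For distant pairs
   [d x y / r n >= 1], and the bound [2 * M <= T] suffices. *)
rewrite mulrDr; have [dxy|dxy] := ltP (d x y) (m n).+1%:R^-1.
  apply: ler_wpDr.
    by rewrite mulr_ge0 ?(ltW T0)// divr_ge0//; case: dM.
  rewrite mulrC; apply: le_trans (Tw n).
  exact: (field_incr_le_modulus dM dC xi_cont xi_dense).
apply: ler_wpDl; first by rewrite mulr_ge0 ?(ltW T0).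
apply: (@le_trans _ _ (T w)).
  apply: le_trans (proj2 (T1 w)).
  exact: (field_incr_le_sup dC xi_cont xi_dense).
by rewrite ler_peMr ?(ltW T0)// ler_pdivlMr ?mul1r.
Qed.

(** * Normalization and the factorized modulus *)

Theorem theorem3p1 (R : realType) (X : Type) (d : X -> X -> R)
  (d0 : measure_display) (Omega : measurableType d0) (P : probability Omega R)
  (xi : X -> Omega -> R) (Phi : R -> R) :
  is_metric d -> d_compact d ->
  (forall x, measurable_fun setT (xi x)) ->
  separable_field P d xi ->
  {ae P, forall w, d_continuous d (fun x => xi x w)} ->
  orlicz Phi -> Delta2 Phi ->
  (luxemburg P Phi (fun w => ereal_sup [set (`|xi x w|)%:E | x in [set: X]])
     < +oo)%E ->
  let D := [set del : R | 0 <= del /\ (del%:E <= diam d)%E] in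
  exists (tau0 : Omega -> R) (g : R -> R),
    [/\ measurable_fun setT tau0,
         (forall w, 0 <= tau0 w) &
         luxemburg P Phi (fun w => (tau0 w)%:E) = 1%E] /\
    [/\ (forall del, D del -> 0 <= g del),
         {within D, continuous g},
         (forall a b, D a -> D b -> a < b -> g a < g b),
         g 0 = 0 &
         g x @[x --> within [set x | D x /\ 0 < x] (nbhs (0:R))] --> (0:R)] /\
    {ae P, forall w, forall del, D del ->
        (modcont d (fun x => xi x w) del <= (tau0 w * g del)%:E)%E}.
Proof.
move=> dM dC mxi xiS xiC PhiO PhiD xiL D.
have [r [T [r0 mT T1 intT Tae]]] := random_modulus dM dC mxi xiS xiC PhiO PhiD xiL.
have [l l0 normT] := luxemburg_normalize PhiO mT T1 intT.
have T0 w : 0 <= T w by exact: le_trans ler01 (T1 w).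
(* The envelope is only known to be nondecreasing, so [|x|] is added for strictness; the factor [l]
   undoes the division of [T] by [l]. *)
pose g x := l * (`|x| + affine_envelope r x).
have g0 : g 0 = 0 by rewrite /g normr0 affine_envelope0// addr0 mulr0.
have cg : continuous g.
  move=> x; apply: cvgM; first exact: cvg_cst.
  apply: cvgD; first exact: norm_continuous.
  exact: affine_envelope_continuous.
exists (fun w => T w / l), g; split; first split => //.
- by apply: measurable_funM.
- by move=> w; rewrite divr_ge0// ltW.
split; first split => //.
- by move=> s _; rewrite mulr_ge0 ?(ltW l0)// addr_ge0// affine_envelope_ge0.
- exact: continuous_subspaceT.
- move=> a b [a0 _] [b0 _] ab; rewrite ltr_pM2l// ltr_leD//.
    by rewrite !ger0_norm.
  by apply: affine_envelope_homo => //; rewrite !ger0_norm// ltW.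
- by apply: cvg_within_filter; have := cg 0; rewrite /continuous_at g0.
apply: filterS Tae => w Tw s [s0 _].
apply: ge_ereal_sup => _ [[x y] /= dxy <-]; rewrite lee_fin.
have Tw0 : 0 < T w by exact: lt_le_trans ltr01 (T1 w).
rewrite /g mulrA divfK ?gt_eqF// mulrDr ler_wpDl ?mulr_ge0//.
(* After division by [T w > 0], the almost sure bounds for all [n] pass to their infimum. *)
rewrite -ler_pdivrMl//; apply: le_affine_envelope => n.
rewrite ler_pdivrMl//; apply: le_trans (Tw x y n) _.
by rewrite ler_wpM2l// lerD2l ler_wpM2r ?invr_ge0 ?(ltW (r0 n))// ger0_norm.
Qed.
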